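(* Let $w=(w(n))_{n\ge 0}$ be a non-decreasing sequence of positive real numbers with $\sum_{n\ge 0}\frac{1}{w(n)}=\infty$, and let $\alpha_c(w)\in[0,\infty]$ be its critical parameter. Then: \begin{enumerate} \item if $w(n)\gg n\log\log n$ then $\alpha_c(w)=0$; \item if $w(n)\asymp n\log\log n$ then $\alpha_c(w)\in(0,\infty)$; \item if $w(n)\ll n\log\log n$ then $\alpha_c(w)=\infty$. \end{enumerate}
   Context: Asymptotic notation (as $n\to\infty$): $f\gg g$ means $f(n)/g(n)\to\infty$; $f\ll g$ means $g\gg f$; $f\asymp g$ means that there is a constant $c>0$ with $c^{-1}f(n)\le g(n)\le c f(n)$ for all $n$ large enough. Critical parameter: extend $w$ to $\mathbb{R}_+$ by $w(t)=w(\lfloor t\rfloor)$ and set $W(t)=\int_0^t \frac{du}{w(u)}$. Since $\sum_n 1/w(n)=\infty$, $W$ is a homeomorphism of $\mathbb{R}_+$, with inverse $W^{-1}$. For $\alpha>0$ let $$I_\alpha(w)=\int_0^\infty \frac{dx}{w(W^{-1}(W(x)+\alpha))}.$$ As $w$ is non-decreasing, $\alpha\mapsto I_\alpha(w)$ is non-increasing, and $\alpha_c(w)=\inf\{\alpha\ge 0: I_\alpha(w)<\infty\}\in[0,\infty]$, with $\inf\emptyset=\infty$. (At $\alpha=0$ one uses the same formula; this does not affect the infimum.) *)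

(* Defs.v *)
From mathcomp Require Import all_boot all_order all_algebra.
From mathcomp Require Import all_classical all_reals all_analysis.

Set Implicit Arguments.
Unset Strict Implicit.
Unset Printing Implicit Defensive.

Import Order.TTheory GRing.Theory Num.Theory.
Import numFieldNormedType.Exports.

Local Open Scope classical_set_scope.
Local Open Scope ring_scope.

(* f >> g and f << g. *)
Definition dominates (R : realType) (f g : nat -> R) : Prop :=
  f n / g n @[n --> \oo] --> +oo.

Definition dominated (R : realType) (f g : nat -> R) : Prop := dominates g f.

Definition comparable_growth (R : realType) (f g : nat -> R) : Prop :=
  exists2 c : R, 0 < c &
    \forall n \near \oo, c^-1 * f n <= g n /\ g n <= c * f n.

(* [ln] is total, with value 0 on nonpositive reals, so the junk values (only
   at n = 0 and n = 1) do not affect asymptotic statements. *)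
Definition n_loglog (R : realType) (n : nat) : R := n%:R * ln (ln n%:R).

Section CriticalParameter.
Context {R : realType}.
Implicit Types (w : nat -> R) (t x s alpha : R).
Local Notation leb := (@lebesgue_measure R).

(* Only meaningful for 0 <= t, where [Num.truncn t] is the floor of t. *)
Definition extend w t : R := w (Num.truncn t).

Definition W w t : R := (\int[leb]_(u in `[0, t]) (extend w u)^-1)%R.

(* Inverse of W on [0, +oo[; it is a two-sided inverse [0, +oo[ -> [0, +oo[
   when w is positive, nondecreasing and \sum_n 1 / w n = +oo. *)
Definition Winv w s : R := 'pinv_(fun=> 0 : R) `[0, +oo[ (W w) s.

Definition I_ w alpha : \bar R :=
  (\int[leb]_(x in `[0%R, +oo[) ((extend w (Winv w (W w x + alpha)))^-1)%:E)%E.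

(* The infimum is taken in \bar R, so that the infimum of set0 is +oo. *)
Definition alpha_c w : \bar R :=
  ereal_inf [set alpha%:E | alpha in [set a : R | 0 <= a /\ (I_ w a < +oo)%E]].

End CriticalParameter.

(* Main.v *)
(* Let y = W^-1(W(x) + a), so that y is determined by int_x^y du/w(u) = a. For
   w(u) = K u loglog u this integral is about log(y/x) / (K loglog x), whence
   y ~ x (log x)^(K a).  If w >= K n loglog n and K a >= 2, then
   w(y) >= K x (log x)^2 and I_a converges; if w <= K n loglog n and
   K a <= 1/4, then y loglog y <= 4 x log x and I_a diverges.  Integrals are
   compared with series over the integers, and all series with telescoping
   ones, using 1/(x + 1) <= ln(x + 1) - ln x <= 1/x. *)
Require Import Defs.
From mathcomp Require Import all_boot all_order all_algebra.
From mathcomp Require Import all_classical all_reals all_analysis.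
From mathcomp Require Import measurable_realfun lra ring.

Set Implicit Arguments.
Unset Strict Implicit.
Unset Printing Implicit Defensive.

Import Order.TTheory GRing.Theory Num.Theory.
Import numFieldNormedType.Exports.

Local Open Scope classical_set_scope.
Local Open Scope ring_scope.

(** * Elementary inequalities for iterated logarithms *)

Section Estimates.
Context {R : realType}.
Implicit Types (f g : nat -> R) (x y : R).

Lemma ler_increments f g (m n : nat) : (m <= n)%N ->
  (forall k, (m <= k < n)%N -> f k.+1 - f k <= g k.+1 - g k) ->
  f n - f m <= g n - g m.
Proof. by move=> mn fg; rewrite -!telescope_sumr//; exact: ler_sum_nat. Qed.

Lemma lnD1_le x : 0 < x -> ln (x + 1) - ln x <= x^-1.
Proof.
move=> x0; have x1 : 0 < x + 1 by rewrite addr_gt0.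
rewrite -ln_div ?posrE// mulrDl divff ?gt_eqF// mul1r.
by rewrite le_ln1Dx// (lt_trans _ (_ : 0 < _)) ?invr_gt0 ?ltrN10.
Qed.

Lemma lnD1_ge x : 0 < x -> (x + 1)^-1 <= ln (x + 1) - ln x.
Proof.
move=> x0; have x1 : 0 < x + 1 by rewrite addr_gt0.
rewrite -[leRHS]opprB -ln_div ?posrE// lerNr.
have -> : x / (x + 1) = 1 + - (x + 1)^-1 by field; rewrite gt_eqF.
rewrite le_ln1Dx// ltrN2 invf_lt1// ltrDr //.
Qed.

Lemma loglog_telescope x : 1 < x ->
  ln (ln (x + 1)) - ln (ln x) <= (x * ln x)^-1.
Proof.
move=> x1; have x0 : 0 < x by exact: lt_trans x1.
have l0 : 0 < ln x by exact: ln_gt0.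
have l1 : 0 < ln (x + 1) by rewrite ln_gt0// ltrDr.
rewrite -ln_div ?posrE//.
have -> : ln (x + 1) / ln x = 1 + (ln (x + 1) - ln x) / ln x.
  by field; rewrite gt_eqF.
have : ln x <= ln (x + 1) by rewrite ler_ln ?posrE ?addr_gt0// lerDl.
rewrite -subr_ge0 => d0.
apply: (le_trans (le_ln1Dx _)).
  by rewrite (lt_le_trans (_ : -1 < 0))// mulr_ge0// invr_ge0 ltW.
by rewrite invfM ler_pM2r ?invr_gt0// lnD1_le.
Qed.

(** The factor 2 pays for [x^-1 <= 2 / (x + 1)], valid as [1 < x]. The mix of [x] and [ln (x + 1)]
    matches the bound that [extend_Winv_ge] provides. *)
Lemma inv_log_telescope x : 1 < x ->
  (x * ln (x + 1) ^+ 2)^-1 <= 2 * ((ln x)^-1 - (ln (x + 1))^-1).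
Proof.
move=> x1; have x0 : 0 < x by exact: lt_trans x1.
have l0 : 0 < ln x by exact: ln_gt0.
have l1 : 0 < ln (x + 1) by rewrite ln_gt0// ltrDr.
have ll : ln x <= ln (x + 1) by rewrite ler_ln ?posrE ?addr_gt0// lerDl.
have -> : (ln x)^-1 - (ln (x + 1))^-1 =
    (ln (x + 1) - ln x) * (ln x * ln (x + 1))^-1.
  by field; rewrite !gt_eqF.
rewrite invfM mulrA; apply: ler_pM.
- by rewrite invr_ge0 ltW.
- by rewrite invr_ge0 exprn_ge0// ltW.
- rewrite (@le_trans _ _ (2 * (x + 1)^-1))//; last first.
    by rewrite ler_pM2l// lnD1_ge.
  rewrite -(@ler_pM2r _ (x * (x + 1))) ?mulr_gt0//; last lra.
  rewrite (_ : x^-1 * _ = x + 1); last by field; rewrite gt_eqF.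
  rewrite (_ : 2 / (x + 1) * _ = 2 * x); first lra.
  by field; rewrite gt_eqF//; lra.
- by rewrite lef_pV2 ?posrE ?exprn_gt0 ?mulr_gt0// expr2 ler_pM2r.
Qed.

(* From ln m <= ln p + (ln ln m)/4 one gets first ln m <= 2 ln p, then
   ln ln m <= 2 ln ln p, and finally m <= p (ln p)^(1/2). *)
Lemma iterated_log_absorb (p m t : R) : 0 < p -> p <= m -> t <= 4^-1 ->
  1 <= ln (ln p) -> 1 <= ln p ->
  ln m - ln p <= t * ln (ln m) -> m * ln (ln m) <= 4 * p * ln p.
Proof.
move=> p0 pm t4 llp lp mp; have m0 := lt_le_trans p0 pm.
have lpm : ln p <= ln m by rewrite ler_ln ?posrE.
have lp0 : 0 < ln p by exact: lt_le_trans lp.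
have lm0 : 0 < ln m by exact: lt_le_trans lpm.
have llpm : ln (ln p) <= ln (ln m) by rewrite ler_ln ?posrE.
have llm : ln (ln m) < ln m by exact: ln_sublinear.
have tm : t * ln (ln m) <= 4^-1 * ln (ln m) by rewrite ler_pM2r//; lra.
have l2 : ln (2 : R) <= 1 by rewrite (_ : 2 = 1 + 1)// le_ln1Dx//; lra.
have llm2 : ln (ln m) <= 2 * ln (ln p).
  have : ln (ln m) <= ln (2 * ln p) by rewrite ler_ln ?posrE//; lra.
  by rewrite lnM ?posrE//; lra.
have mle : m <= p * expR (ln (ln p) / 2).
  rewrite -[leLHS]lnK ?posrE// -[X in X * _]lnK ?posrE// -expRD ler_expR.
  lra.
(* Let [e] be this exponential, that is [(ln p)^(1/2)]. From [e >= 1 + ln (ln p) / 2] comes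
   [ln (ln m) <= 4 e]; one factor [e] of [ln p] bounds [m], the other bounds [ln (ln m)]. *)
have e2 := expR_ge1Dx (ln (ln p) / 2).
have e0 := expR_gt0 (ln (ln p) / 2).
have -> : 4 * p * ln p =
    (p * expR (ln (ln p) / 2)) * (4 * expR (ln (ln p) / 2)).
  rewrite -[X in _ * _ * X]lnK ?posrE// [X in expR X]splitr expRD; ring.
by apply: ler_pM => //; [exact: ltW|lra|lra].
Qed.

Lemma ln_homo x y : 0 < x -> x <= y -> ln x <= ln y.
Proof. by move=> x0 xy; rewrite ler_ln ?posrE// (lt_le_trans x0). Qed.

Lemma loglog_homo x y : 1 < x -> x <= y -> ln (ln x) <= ln (ln y).
Proof.
by move=> x1 xy; rewrite ln_homo ?ln_gt0// ln_homo// (lt_trans _ x1).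
Qed.

(** As [ln] is 0 on nonpositive reals, a positive value rules out that default, first for [ln x] and
    then for [x]. Positivity side conditions are later drawn from this. *)
Lemma loglog_ge1 x : 1 <= ln (ln x) -> 1 < ln x /\ 1 < x.
Proof.
move=> llx; have lx0 : 0 < ln x.
  by rewrite ltNge; apply/negP => lx; move: llx; rewrite ln0// ler10.
have lx : 1 < ln x by rewrite (le_lt_trans llx)// ln_sublinear.
have x0 : 0 < x.
  by rewrite ltNge; apply/negP => x0; move: lx0; rewrite ln0// ltxx.
by split=> //; rewrite (lt_trans lx)// ln_sublinear.
Qed.

Lemma near_loglog_ge (A : R) : \forall n \near \oo, A <= ln (ln n%:R).
Proof.
have [N _ NA] := nbhs_infty_ger (expR (expR A)).
exists N => // n /= /NA en.
by rewrite -[leLHS]expRK ln_homo ?expR_gt0// -[leLHS]expRK ln_homo ?expR_gt0.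
Qed.

End Estimates.

(** * Series against telescoping sums, and integrals against series *)

Section SeriesAndIntegrals.
Context {R : realType}.
Implicit Types (u b : nat -> R) (h : R -> R).

Lemma nneseries_telescope_lty u b :
  (forall n, 0 <= u n) -> (forall n, 0 <= b n) ->
  (\forall n \near \oo, u n.+1 <= b n - b n.+1) ->
  (\sum_(0 <= n <oo) (u n)%:E < +oo)%E.
Proof.
move=> u0 b0 [N _ ub].
have bound n : \sum_(0 <= k < n) u k <= \sum_(0 <= k < N.+1) u k + b N.
  (* The induction carries the telescoped term [- b (N + m)], dropped at the end because [b] is
     nonnegative. *)
  have le1 m : \sum_(0 <= k < N.+1 + m) u k <=
      \sum_(0 <= k < N.+1) u k + b N - b (N + m)%N.
    elim: m => [|m IH]; first by rewrite !addn0 addrK.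
    have U : u (N + m).+1 <= b (N + m)%N - b (N + m).+1 := ub _ (leq_addr _ _).
    rewrite [(N.+1 + _)%N]addnS addnS big_nat_recr//=; rewrite addSn in IH *.
    lra.
  apply: (@le_trans _ _ (\sum_(0 <= k < N.+1 + n) u k)); last first.
    by apply: (le_trans (le1 n)); rewrite lerBlDr lerDl.
  rewrite [leRHS](@big_cat_nat _ _ _ n)//=; last exact: leq_addl.
  by rewrite lerDl sumr_ge0.
apply: (@le_lt_trans _ _ (\sum_(0 <= k < N.+1) u k + b N)%:E); last exact: ltry.
apply: lime_le; first by apply: is_cvg_nneseries => n _ _; rewrite lee_fin.
by apply: nearW => n; rewrite sumEFin lee_fin.
Qed.

Lemma nneseries_telescope_y u b :
  (forall n, 0 <= u n) -> b n @[n --> \oo] --> +oo ->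
  (\forall n \near \oo, b n.+1 - b n <= u n) ->
  (\sum_(0 <= n <oo) (u n)%:E = +oo)%E.
Proof.
move=> u0 /cvgryPge boo [N _ ub]; apply/eqyP => A A0.
(* Beyond [M], [b] exceeds its value at [N] by at least [A], and so does the sum from [N] on. *)
have [M _ bM] := boo (A + b N).
pose m := maxn M N.
apply: (@le_trans _ _ (\sum_(0 <= k < m) (u k)%:E)%E); last first.
  by apply: nneseries_lim_ge => n _ _; rewrite lee_fin.
rewrite sumEFin lee_fin.
have Nm : (N <= m)%N by rewrite leq_maxr.
rewrite (@big_cat_nat _ _ _ N)//=.
apply: (@le_trans _ _ (\sum_(N <= k < m) u k)); last by rewrite lerDr sumr_ge0.
apply: (@le_trans _ _ (b m - b N)).
  by rewrite lerBrDr; apply: bM; rewrite /= leq_maxl.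
rewrite -telescope_sumr//; apply: ler_sum_nat => k /andP[Nk _].
exact: ub.
Qed.

Lemma itv0y_bigcup_unit :
  `[0%R, +oo[%classic = \bigcup_n `[n%:R, n.+1%:R[%classic :> set R.
Proof.
apply/seteqP; split => [x|x [n _]] /=; rewrite !in_itv/= ?andbT.
  by move=> x0; exists (Num.truncn x) => //=; rewrite in_itv/= truncn_itv.
by move=> /andP[nx _]; rewrite (le_trans _ nx).
Qed.

Lemma trivIset_unit :
  trivIset setT (fun n : nat => `[n%:R, n.+1%:R[%classic : set R).
Proof.
move=> i j _ _ [x [/=]]; rewrite !in_itv/=.
by move=> /truncn_def <- /truncn_def <-.
Qed.

Lemma integral_unit_itv (h : R -> R) :
  (forall x, 0 <= h x) -> nonincreasing_fun h ->
  (\int[lebesgue_measure]_(x in `[0%R, +oo[) (h x)%:E =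
   \sum_(0 <= n <oo)
     \int[lebesgue_measure]_(x in `[n%:R, n.+1%:R[) (h x)%:E)%E.
Proof.
move=> h0 hni; rewrite itv0y_bigcup_unit ge0_integral_bigcup//.
- apply/measurable_EFinP; apply: nonincreasing_measurable => //.
  by rewrite -itv0y_bigcup_unit.
- by move=> x _; rewrite lee_fin.
- exact: trivIset_unit.
Qed.

Lemma integral_unit_cst (n : nat) (c : R) :
  (\int[lebesgue_measure]_(x in `[(n%:R : R), n.+1%:R[) c%:E = c%:E)%E.
Proof.
rewrite integral_cst//= lebesgue_measure_itv/= lte_fin ltr_nat ltnSn.
by rewrite -EFinB -natrB// subSnn mule1.
Qed.

(** This half of the integral test uses left endpoints; [nneseries_le_integral] uses right ones,
    hence its index [n.+1]. *)
Lemma integral_le_nneseries h :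
  (forall x, 0 <= h x) -> nonincreasing_fun h ->
  (\int[lebesgue_measure]_(x in `[0%R, +oo[) (h x)%:E <=
   \sum_(0 <= n <oo) (h n%:R)%:E)%E.
Proof.
move=> h0 hni; rewrite integral_unit_itv//; apply: lee_nneseries => n _ *.
  by apply: integral_ge0 => x _; rewrite lee_fin.
rewrite -[leRHS](integral_unit_cst n); apply: ge0_le_integral => //=.
- by move=> x _; rewrite lee_fin.
- by apply/measurable_EFinP; exact: nonincreasing_measurable.
- by move=> x; rewrite in_itv/= lee_fin => /andP[nx _]; exact: hni.
Qed.

Lemma nneseries_le_integral h :
  (forall x, 0 <= h x) -> nonincreasing_fun h ->
  (\sum_(0 <= n <oo) (h n.+1%:R)%:E <=
   \int[lebesgue_measure]_(x in `[0%R, +oo[) (h x)%:E)%E.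
Proof.
move=> h0 hni; rewrite integral_unit_itv//; apply: lee_nneseries => n _ *.
  by rewrite lee_fin.
rewrite -[leLHS](integral_unit_cst n); apply: ge0_le_integral => //=.
- by move=> x _; rewrite lee_fin.
- by apply/measurable_EFinP; exact: nonincreasing_measurable.
- by move=> x; rewrite in_itv/= lee_fin => /andP[_ nx]; apply: hni; exact: ltW.
Qed.

End SeriesAndIntegrals.

(** * The function [W] and its inverse *)

Section ExtendedWeight.
Context {R : realType} (w : nat -> R)
  (w_gt0 : forall n : nat, 0 < w n)
  (w_nd : forall m n : nat, (m <= n)%N -> w m <= w n)
  (w_div : (\sum_(0 <= n <oo) ((w n)^-1)%:E)%E = (+oo)%E).
Local Notation leb := (@lebesgue_measure R).

Lemma extend_gt0 x : 0 < extend w x. Proof. exact: w_gt0. Qed.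

Lemma extend_nat (n : nat) : extend w n%:R = w n.
Proof. by rewrite /extend natrK. Qed.

(** [Num.truncn] is 0 on negative reals, so monotonicity holds on the whole line; it also yields
    measurability. *)
Lemma extendV_nonincreasing : nonincreasing_fun (fun x => (extend w x)^-1).
Proof.
by move=> x y xy; rewrite lef_pV2 ?posrE ?extend_gt0// w_nd// le_truncn.
Qed.

Lemma extendV_integrable (i : interval R) : (leb [set` i] < +oo)%E ->
  leb.-integrable [set` i] (EFin \o fun x => (extend w x)^-1).
Proof.
move=> ioo; apply: measurable_bounded_integrable => //.
  by apply: nonincreasing_measurable => //; exact: extendV_nonincreasing.
exists (w 0)^-1; split; first exact: num_real.
move=> M wM x _ /=.
rewrite ger0_norm; last by rewrite invr_ge0 ltW// extend_gt0.
by rewrite (le_trans _ (ltW wM))// lef_pV2 ?posrE ?extend_gt0// w_nd.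
Qed.

(** On []x, y]] the monotone integrand lies between its values at the endpoints. This takes the
    place of a derivative of [W]: strict monotonicity and the unit increments follow from it. *)
Lemma W_increment x y : 0 <= x -> x <= y ->
  (y - x) / extend w y <= W w y - W w x <= (y - x) / extend w x.
Proof.
move=> x0 xy; rewrite /W Rintegral_itvB ?bnd_simp//; last first.
  apply: extendV_integrable; rewrite lebesgue_measure_itv/=.
  by case: ifPn => // _; rewrite -EFinB ltry.
have mi : (leb `]x, y] < +oo)%E.
  by rewrite lebesgue_measure_itv/=; case: ifPn => // _; rewrite -EFinB ltry.
have mul_cst c : (y - x) * c = \int[leb]_(z in `]x, y]) c.
  rewrite Rintegral_cst//= mulrC lebesgue_measure_itv/= lte_fin.
  move: xy; rewrite le_eqVlt => /predU1P[->|->//].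
  by rewrite ltxx subrr.
have cst_int c : leb.-integrable `]x, y] (EFin \o fun=> c).
  by apply: measurable_bounded_integrable => //; exact: bounded_cst.
rewrite !mul_cst; apply/andP; split; apply: le_Rintegral => //.
- exact: extendV_integrable.
- by move=> z; rewrite /= in_itv/= => /andP[_ zy]; exact: extendV_nonincreasing.
- exact: extendV_integrable.
- move=> z; rewrite /= in_itv/= => /andP[xz _].
  by apply: extendV_nonincreasing; exact: ltW.
Qed.

Lemma W_nondecreasing x y : 0 <= x -> x <= y -> W w x <= W w y.
Proof.
move=> x0 xy; rewrite -subr_ge0; have /andP[+ _] := W_increment x0 xy.
by apply: le_trans; rewrite divr_ge0 ?subr_ge0// ltW ?extend_gt0.
Qed.

Lemma W_increasing x y : 0 <= x -> x < y -> W w x < W w y.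
Proof.
move=> x0 xy; rewrite -subr_gt0; have /andP[+ _] := W_increment x0 (ltW xy).
by apply: lt_le_trans; rewrite divr_gt0 ?subr_gt0// extend_gt0.
Qed.

(** The interval of integration is empty or a point. This extends monotonicity of [W] to all reals,
    as [nonincreasing_fun] demands of the integrand of [I_]. *)
Lemma W_le0 x : x <= 0 -> W w x = 0.
Proof.
rewrite /W le_eqVlt => /predU1P[->|x0].
  by rewrite set_itv1 Rintegral_set1.
by rewrite set_itv_ge ?Rintegral_set0// bnd_simp -ltNge.
Qed.

Lemma W_ge0 x : 0 <= W w x.
Proof.
have [x0|/ltW/W_le0->//] := leP 0 x.
by rewrite -(@W_le0 0)// W_nondecreasing.
Qed.

Lemma W_homo x y : x <= y -> W w x <= W w y.
Proof.
move=> xy; have [x0|x0] := leP 0 x; first exact: W_nondecreasing.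
by rewrite W_le0 ?W_ge0// ltW.
Qed.

Lemma W_increment_nat (n : nat) :
  (w n.+1)^-1 <= W w n.+1%:R - W w n%:R <= (w n)^-1.
Proof.
have := @W_increment n%:R n.+1%:R (ler0n _ _).
by rewrite ler_nat -natrB// subSnn !extend_nat !mul1r => ->.
Qed.

Lemma W_unbounded (A : R) : exists n : nat, A <= W w n%:R.
Proof.
apply: contrapT => /forallNP WA.
(* The lower bound on an increment of [W] is [(w k.+1)^-1], so the series is compared after a shift
   and its first term [(w 0)^-1] is added to the bound. *)
suff : (\sum_(0 <= n <oo) ((w n)^-1)%:E <= (A + (w 0)^-1)%:E)%E.
  by rewrite w_div leye_eq.
apply: lime_le.
  by apply: is_cvg_nneseries => n _ _; rewrite lee_fin invr_ge0 ltW.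
apply: nearW => n; rewrite sumEFin lee_fin.
apply: (@le_trans _ _ (\sum_(0 <= k < n.+1) (w k)^-1)).
  by rewrite big_nat_recr//= lerDl invr_ge0 ltW.
rewrite big_nat_recl// addrC lerD2r.
apply: (@le_trans _ _ (W w n%:R - W w 0%:R)).
  rewrite -(@telescope_sumr _ _ _ (fun k => W w k%:R))//.
  by apply: ler_sum_nat => k _; have /andP[] := W_increment_nat k.
rewrite [W w 0%:R]W_le0// subr0.
by move: (WA n) => /negP; rewrite -ltNge => /ltW.
Qed.

Lemma W_surj : set_surj `[0%R, +oo[ `[0%R, +oo[ (W w).
Proof.
move=> s /=; rewrite in_itv/= andbT => s0.
have [n sn] := W_unbounded s.
have [||c c0n <-] := @IVT _ (W w) 0 n%:R s (ler0n _ _).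
- apply: parameterized_integral_continuous => //.
  apply: extendV_integrable; rewrite lebesgue_measure_itv/=.
  by case: ifPn => // _; rewrite -EFinB ltry.
- by rewrite [W w 0]W_le0// ge_min s0 le_max sn orbT.
by exists c => //; move: c0n; rewrite /= !in_itv/= andbT => /andP[].
Qed.

(** Surjectivity makes the partial inverse a right inverse; with [Winv_ge0] and strict monotonicity
    of [W], this yields the order properties below. *)
Lemma WinvK s : 0 <= s -> W w (Winv w s) = s.
Proof.
by move=> s0; apply: (surjpK (fun=> 0) W_surj); rewrite inE/= in_itv/= andbT.
Qed.

Lemma Winv_ge0 s : 0 <= s -> 0 <= Winv w s.
Proof.
move=> s0; suff : `[0%R, +oo[%classic (Winv w s) by rewrite /= in_itv/= andbT.
by apply: (surjpinv_image_sub W_surj); exists s => //=; rewrite in_itv/= andbT.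
Qed.

Lemma Winv_homo s t : 0 <= s -> s <= t -> Winv w s <= Winv w t.
Proof.
move=> s0 st; have t0 := le_trans s0 st; rewrite leNgt; apply/negP => ts.
by have := W_increasing (Winv_ge0 t0) ts; rewrite !WinvK// ltNge st.
Qed.

Lemma Winv_W_ge x a : 0 <= x -> 0 <= a -> x <= Winv w (W w x + a).
Proof.
move=> x0 a0; rewrite leNgt; apply/negP => yx.
have Wa0 : 0 <= W w x + a by rewrite addr_ge0// W_ge0.
by have := W_increasing (Winv_ge0 Wa0) yx; rewrite WinvK// ltNge lerDl a0.
Qed.

(** * Bounds on the integrand of [I_] *)

Let integrand a x := (extend w (Winv w (W w x + a)))^-1.

Lemma integrand_ge0 a x : 0 <= integrand a x.
Proof. by rewrite invr_ge0 ltW// extend_gt0. Qed.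

Lemma integrand_nonincreasing a : 0 <= a -> nonincreasing_fun (integrand a).
Proof.
move=> a0 x y xy; apply: extendV_nonincreasing.
by rewrite Winv_homo ?addr_ge0 ?W_ge0// lerD2r W_homo.
Qed.

Lemma le_truncn_Winv (n : nat) a :
  0 <= a -> (n <= Num.truncn (Winv w (W w n%:R + a)))%N.
Proof. by move=> a0; rewrite -[leqLHS](@natrK R) le_truncn// Winv_W_ge. Qed.

(** With [m] the floor of the inverse, [W] gains at least [a] from [p.+1] to [m.+1]. Freezing
    [ln (ln k)] at [p.+1], its least value there, the gain is at most
    [ln (m / p) / (K * ln (ln p.+1))], which forces [m >= p * ln p.+1 ^+ 2]. *)
Lemma extend_Winv_ge (K a : R) (N p : nat) : 0 < K -> 2 <= K * a ->
  (forall n, (N <= n)%N -> K * n_loglog R n <= w n) ->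
  (N <= p)%N -> 1 < p%:R :> R -> 1 <= ln (ln p.+1%:R : R) ->
  K * (p%:R * ln p.+1%:R ^+ 2) <= extend w (Winv w (W w p.+1%:R + a)).
Proof.
move=> K0 Ka wN Np p1 llp.
have a0 : 0 <= a by rewrite -(pmulr_rge0 _ K0); lra.
have [lp1 pS1] := loglog_ge1 llp.
have p0 : 0 < p%:R :> R by lra.
rewrite /extend; set y := Winv w _; set m := Num.truncn y.
have pm : (p.+1 <= m)%N by exact: le_truncn_Winv.
have pmR : p.+1%:R <= m%:R :> R by rewrite ler_nat.
have Wa0 : 0 <= W w p.+1%:R + a by rewrite addr_ge0 ?W_ge0.
have Wm : a <= W w m.+1%:R - W w p.+1%:R.
  rewrite lerBrDl -(WinvK Wa0); apply: W_homo.
  by have /andP[_ /ltW] := truncn_itv (Winv_ge0 Wa0).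
pose C := (K * ln (ln p.+1%:R))^-1.
have Kll0 : 0 < K * ln (ln p.+1%:R) by rewrite mulr_gt0//; lra.
have WC : W w m.+1%:R - W w p.+1%:R <= C * ln m%:R - C * ln p%:R.
  (* The predecessor is there because the increment at [k] is at most [(w k)^-1 <= C / k <= C * (ln
     k - ln k.-1)]. *)
  apply: (@ler_increments _ (fun k => W w k%:R) (fun k => C * ln k.-1%:R)).
    exact: leqW.
  move=> [//|j] /andP[pj _] /=.
  have pjR : p%:R <= j%:R :> R by rewrite ler_nat.
  have j0 : 0 < j%:R :> R by lra.
  have /andP[_ /le_trans] := W_increment_nat j.+1; apply.
  rewrite -mulrBr; apply: (@le_trans _ _ (C * (j%:R + 1)^-1)); last first.
    by rewrite -natr1 ler_pM2l ?invr_gt0// lnD1_ge.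
  rewrite natr1 /C -invfM lef_pV2 ?posrE ?mulr_gt0//; last lra.
  apply: le_trans (wN _ (leq_trans Np (leqW pj))).
  rewrite -mulrA ler_pM2l// mulrC /n_loglog ler_pM2l//.
  by rewrite loglog_homo// ler_nat.
have llm : 2 * ln (ln p.+1%:R) <= ln m%:R - ln p%:R :> R.
  have := le_trans Wm WC; rewrite -mulrBr mulrC ler_pdivlMr// => H.
  apply: le_trans H; rewrite mulrA [a * K]mulrC ler_pM2r//; lra.
have plm : p%:R * ln p.+1%:R ^+ 2 <= m%:R :> R.
  have lp0 : 0 < ln p.+1%:R :> R by lra.
  have m0 : 0 < m%:R :> R by lra.
  rewrite -ler_ln ?posrE ?mulr_gt0 ?exprn_gt0//.
  rewrite lnM ?posrE ?exprn_gt0// lnXn// -[X in _ + X]mulr_natl; lra.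
have Nm : (N <= m)%N by rewrite (leq_trans Np)// (leq_trans _ pm).
apply: le_trans (wN _ Nm); rewrite ler_pM2l//; apply: (le_trans plm).
rewrite /n_loglog ler_peMr//; exact: le_trans llp (loglog_homo _ pmR).
Qed.

(** Now [W] gains at most [a] from [n] to the floor [m], and [ln (ln k)] is frozen above, at [m.+1].
    The unknown [m] then stands on both sides of the estimate, and [iterated_log_absorb] resolves
    this with [t = a * K]. *)
Lemma extend_Winv_le (K a : R) (N n : nat) : 0 < K -> 0 <= a -> a * K <= 4^-1 ->
  (forall n, (N <= n)%N -> w n <= K * n_loglog R n) ->
  (N <= n)%N -> (1 < n)%N -> 1 <= ln (ln n%:R : R) ->
  extend w (Winv w (W w n%:R + a)) <= 4 * K * (n.+1%:R * ln n.+1%:R).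
Proof.
move=> K0 a0 aK wN Nn n1 lln.
have n1R : 1 < n%:R :> R by rewrite ltr1n.
have nn1 : n%:R <= n.+1%:R :> R by rewrite ler_nat.
have llnS : 1 <= ln (ln n.+1%:R : R) by exact: le_trans (loglog_homo _ nn1).
rewrite /extend; set y := Winv w _; set m := Num.truncn y.
have nm : (n <= m)%N by exact: le_truncn_Winv.
have nmR : n.+1%:R <= m.+1%:R :> R by rewrite ler_nat.
have Wa0 : 0 <= W w n%:R + a by rewrite addr_ge0 ?W_ge0.
have Wm : W w m%:R - W w n%:R <= a.
  rewrite lerBlDl -(WinvK Wa0); apply: W_homo.
  by have /andP[] := truncn_itv (Winv_ge0 Wa0).
have llm : 1 <= ln (ln m.+1%:R : R).
  by apply: le_trans llnS (loglog_homo _ nmR); lra.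
pose D := (K * ln (ln m.+1%:R))^-1.
have Kll0 : 0 < K * ln (ln m.+1%:R) by rewrite mulr_gt0//; lra.
have WD : D * ln m.+1%:R - D * ln n.+1%:R <= W w m%:R - W w n%:R.
  apply: (@ler_increments _ (fun k => D * ln k.+1%:R)
    (fun k => W w k%:R)) => //.
  move=> j /andP[nj jm].
  have njR : n.+1%:R <= j.+1%:R :> R by rewrite ler_nat.
  have j0 : 0 < j.+1%:R :> R by lra.
  have /andP[Wj _] := W_increment_nat j; apply: le_trans Wj.
  rewrite -mulrBr; apply: (@le_trans _ _ (D * (j.+1%:R)^-1)).
    by rewrite -[j.+2%:R]natr1 ler_pM2l ?invr_gt0// lnD1_le.
  rewrite /D -invfM lef_pV2 ?posrE ?mulr_gt0//; last lra.
  apply: le_trans (wN _ (leq_trans Nn (leqW nj))) _.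
  rewrite -mulrA ler_pM2l// [leRHS]mulrC /n_loglog ler_pM2l//.
  by rewrite loglog_homo// ?ler_nat ?ltnS//; [lra|exact: ltnW].
have m_le : m.+1%:R * ln (ln m.+1%:R) <= 4 * n.+1%:R * ln n.+1%:R :> R.
  have [ln1 _] := loglog_ge1 llnS.
  apply: (@iterated_log_absorb _ _ _ (a * K)) => //; [exact: ltW|].
  have := le_trans WD Wm; rewrite -mulrBr mulrC ler_pdivrMr//.
  by rewrite mulrA.
have Nm : (N <= m)%N by exact: leq_trans nm.
apply: (le_trans (wN _ Nm)).
have -> : 4 * K * (n.+1%:R * ln n.+1%:R) = K * (4 * n.+1%:R * ln n.+1%:R).
  by ring.
rewrite ler_pM2l//; apply: le_trans m_le; rewrite /n_loglog.
have m1 : 1 < m%:R :> R by rewrite ltr1n (leq_trans n1).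
have mm1 : m%:R <= m.+1%:R :> R by rewrite ler_nat.
apply: ler_pM => //; last exact: loglog_homo.
have lnm : 1 <= ln (ln m%:R : R).
  by apply: le_trans lln (loglog_homo _ _); rewrite ?ler_nat.
lra.
Qed.

(** * Convergence and divergence of [I_] *)

Lemma I_lty (K a : R) : 0 < K -> 2 <= K * a ->
  (\forall n \near \oo, K * n_loglog R n <= w n) -> (I_ w a < +oo)%E.
Proof.
move=> K0 Ka [N _ wN].
have a0 : 0 <= a by rewrite -(pmulr_rge0 _ K0); lra.
apply: (le_lt_trans (integral_le_nneseries (integrand_ge0 a)
  (integrand_nonincreasing a0))).
(* At [n = 0] the default [ln 0 = 0] keeps the comparison sequence nonnegative. *)
have lnN0 (n : nat) : 0 <= (ln n%:R : R).
  by case: n => [|n]; [rewrite ln0|rewrite ln_ge0// ler1n].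
apply: (@nneseries_telescope_lty _ _ (fun n => K^-1 * (2 * (ln n%:R)^-1))).
- by move=> n; exact: integrand_ge0.
- by move=> n; rewrite !mulr_ge0 ?invr_ge0// ltW.
have [M _ ll] := near_loglog_ge (1 : R).
exists (maxn 2 (maxn N M)) => // p /=; rewrite !geq_max => /and3P[p2 Np Mp].
have p1 : 1 < p%:R :> R by rewrite ltr1n.
have ll1 := ll _ (leqW Mp); have [lp1 _] := loglog_ge1 ll1.
rewrite -!mulrBr; apply: (@le_trans _ _ (K^-1 * (p%:R * ln p.+1%:R ^+ 2)^-1)).
  have lp0 : 0 < ln p.+1%:R :> R by lra.
  rewrite -invfM lef_pV2 ?posrE ?extend_gt0 ?mulr_gt0 ?exprn_gt0//; last lra.
  exact: (extend_Winv_ge K0 Ka wN Np p1 ll1).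
by rewrite ler_pM2l ?invr_gt0// -natr1 inv_log_telescope.
Qed.

Lemma I_y (K a : R) : 0 < K -> 0 <= a -> a * K <= 4^-1 ->
  (\forall n \near \oo, w n <= K * n_loglog R n) -> I_ w a = +oo%E.
Proof.
move=> K0 a0 aK [N _ wN]; apply/eqP; rewrite -leye_eq.
apply: (le_trans _ (nneseries_le_integral (integrand_ge0 a)
  (integrand_nonincreasing a0))).
(* The shift by 2 adds up: the series samples the integrand at [n.+1], and [extend_Winv_le] raises
   the index once more. *)
rewrite (@nneseries_telescope_y _ _
  (fun n => (4 * K)^-1 * ln (ln n.+2%:R)))//.
- by move=> n; exact: integrand_ge0.
- apply/cvgryPge => A; have [M _ ll] := near_loglog_ge (4 * K * A).
  exists M => // n /= Mn; rewrite ler_pdivlMl ?mulr_gt0//.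
  by apply: ll; rewrite /= !leqW.
have [M _ ll] := near_loglog_ge (1 : R).
exists (maxn 1 (maxn N M)) => // n /=; rewrite !geq_max => /and3P[n1 Nn Mn].
have n2 : 1 < n.+2%:R :> R by rewrite ltr1n.
have ln2 : 0 < ln n.+2%:R :> R by exact: ln_gt0.
rewrite -mulrBr.
apply: (@le_trans _ _ ((4 * K)^-1 * (n.+2%:R * ln n.+2%:R)^-1)).
  by rewrite ler_pM2l ?invr_gt0 ?mulr_gt0// -[n.+3%:R]natr1 loglog_telescope.
rewrite -invfM lef_pV2 ?posrE ?extend_gt0 ?mulr_gt0//.
by apply: (extend_Winv_le K0 a0 aK wN) => //; [exact: leqW|exact: ll (leqW Mn)].
Qed.

End ExtendedWeight.

(** * The three growth regimes *)

Theorem proposition1p2 (R : realType) (w : nat -> R)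
    (w_gt0 : forall n : nat, 0 < w n)
    (w_nd : forall m n : nat, (m <= n)%N -> w m <= w n)
    (w_div : (\sum_(0 <= n <oo) ((w n)^-1)%:E)%E = (+oo)%E) :
  [/\ dominates w (@n_loglog R) -> alpha_c w = 0%E,
      comparable_growth w (@n_loglog R) ->
        (0 < alpha_c w)%E /\ (alpha_c w < +oo)%E
    & dominated w (@n_loglog R) -> alpha_c w = (+oo)%E].
Proof.
have alpha_le (K a : R) : 0 < K -> 2 <= K * a ->
    (\forall n \near \oo, K * n_loglog R n <= w n) -> (alpha_c w <= a%:E)%E.
  move=> K0 Ka wK; apply: ereal_inf_lbound; exists a => //; split.
    by rewrite -(pmulr_rge0 _ K0); lra.
  exact: I_lty wK.
have alpha_ge (K a : R) : 0 < K -> a * K <= 4^-1 ->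
    (\forall n \near \oo, w n <= K * n_loglog R n) -> (a%:E <= alpha_c w)%E.
  (* Any [b < a] in the set would satisfy [b * K <= 4^-1] as well, where the integral is
     infinite. *)
  move=> K0 aK wK; apply: le_ereal_inf_tmp => _ [b [b0 Ib] <-].
  rewrite lee_fin leNgt; apply/negP => ba; move: Ib.
  rewrite (I_y w_gt0 w_nd w_div K0 b0 _ wK)//.
  by rewrite (le_trans _ aK)// ler_pM2r// ltW.
(* Eventual positivity allows the denominator of [w n / n_loglog R n] to be cleared. *)
have near_n_loglog_gt0 : \forall n \near \oo, 0 < n_loglog R n.
  have [N _ NR] := near_loglog_ge (1 : R).
  exists N => // n /NR ll; have [l1 n1] := loglog_ge1 ll.
  by rewrite mulr_gt0//; lra.
split.
- move=> /cvgryPge dom; apply/eqP; rewrite eq_le; apply/andP; split.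
    apply/lee_addgt0Pr => e e0; rewrite add0e.
    (* [K = 2 / e] is chosen so that [K * e = 2]; domination provides every [K]. *)
    apply: (alpha_le (2 / e)); rewrite ?divr_gt0 ?divfK ?gt_eqF//.
    near=> n; rewrite -ler_pdivlMr; last by near: n.
    by near: n; exact: dom.
  by apply: le_ereal_inf_tmp => _ [a [a0 _] <-]; rewrite lee_fin.
- move=> [c c0 wc]; split.
    have : ((4 * c)^-1%:E <= alpha_c w)%E.
      (* Each half of comparability gives one bound: [K = c] with [a * K = 4^-1] here, then
         [K = c^-1] with [K * a = 2]. *)
      apply: (alpha_ge c) => //; first by rewrite invfM mulfVK ?gt_eqF.
      by apply: filterS wc => n [+ _]; rewrite ler_pdivrMl.
    by apply: lt_le_trans; rewrite lte_fin invr_gt0 mulr_gt0.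
  have : (alpha_c w <= (2 * c)%:E)%E.
    apply: (alpha_le c^-1); rewrite ?invr_gt0//.
      by rewrite mulrCA mulVf ?gt_eqF// mulr1.
    by apply: filterS wc => n [_ +]; rewrite ler_pdivrMl.
  by move=> /le_lt_trans; apply; exact: ltry.
- move=> /cvgryPge dom; apply/eqyP => A A0.
  (* Since [n_loglog R n / w n >= 4 * A] eventually, this [K] reaches the arbitrary level [A]. *)
  apply: (alpha_ge (4 * A)^-1); first by rewrite invr_gt0 mulr_gt0.
    by rewrite mulrC invfM mulfVK ?gt_eqF.
  near=> n; rewrite ler_pdivlMl ?mulr_gt0// -ler_pdivlMr//.
  by near: n; exact: dom.
Unshelve. all: by end_near.
Qed.
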